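(* Let $\mathcal X\subset\mathbb R^n$ be a nonempty closed convex set, $\|\cdot\|$ a norm on $\mathbb R^n$ with conjugate norm $\|\cdot\|_*$, and $h$ an $\mathcal X$-regularizer that is strongly convex (with modulus 1) with respect to $\|\cdot\|$. Let $M>0$ and let $f:\mathbb R^n\to\mathbb R\cup\{+\infty\}$ be a convex function with $\operatorname{dom}f\supset\mathcal X$, sub-differentiable on $\mathcal X$ (i.e. $\partial f(x)\neq\emptyset$ for $x\in\mathcal X$), such that $\|\zeta\|_*\le M$ for all $x\in\mathcal X$ and $\zeta\in\partial f(x)$. Assume that $f$ attains its minimum $f_*$ over $\mathcal X$ at some $x_*\in\mathcal X$, and that $x_*\in\operatorname{dom}h$. Let $(\gamma_t)_{t\ge1}$ be positive step-sizes, and let $(x_t,y_t,\vartheta_t)_{t\ge1}$ satisfy $x_1=y_1$, $\vartheta_1\in\partial h(x_1)$ and, for $t\ge1$, $$(x_{t+1},\vartheta_{t+1})\in\Pi_h(\vartheta_t-\gamma_tf'(y_t)),\qquad y_{t+1}=(1-\nu_t)y_t+\nu_tx_{t+1},$$ where $f'(y_t)\in\partial f(y_t)$ and $\nu_t=\gamma_{t+1}\big(\sum_{s=1}^{t+1}\gamma_s\big)^{-1}$. Then for all $T\ge1$, $$f(y_T)-f_*\le\Big(\sum_{t=1}^T\gamma_t\Big)^{-1}\Big[D_h(x_*,x_1;\vartheta_1)+\frac{M^2}{2}\sum_{t=1}^T\gamma_t^2\Big].$$ In particular, for $T\ge 1$ and constant step-sizes $\gamma_t\equiv\gamma=\frac{\Omega_{\mathcal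 X}}{M\sqrt T}$, $t\ge1$, where $\Omega_{\mathcal X}>0$ is an upper bound on $\sqrt{2D_h(x_*,x_1;\vartheta_1)}$, one has $$f(y_T)-f_*\le\frac{\Omega_{\mathcal X}M}{\sqrt T}.$$
   Context: $\langle\cdot,\cdot\rangle$ is the canonical scalar product on $\mathbb R^n$; $\|\vartheta\|_*=\max_{\|x\|\le1}\langle\vartheta,x\rangle$. For convex $g:\mathbb R^n\to\mathbb R\cup\{+\infty\}$: $\operatorname{dom}g=\{x:g(x)<\infty\}$; $\partial g(x)$ is the set of $\vartheta\in\mathbb R^n$ with $g(x')-g(x)\ge\langle\vartheta,x'-x\rangle$ for all $x'\in\mathbb R^n$; $g^*(\vartheta)=\sup_{x}\{\langle\vartheta,x\rangle-g(x)\}$; for $\vartheta\in\partial g(x)$, the Bregman divergence with subgradient $\vartheta$ is $D_g(x',x;\vartheta)=g(x')-g(x)-\langle\vartheta,x'-x\rangle$. $g$ is strongly convex (modulus 1) w.r.t. $\|\cdot\|$ if $g(\lambda x+(1-\lambda)x')\le\lambda g(x)+(1-\lambda)g(x')-\frac{\lambda(1-\lambda)}2\|x'-x\|^2$ for all $x,x'\in\mathbb R^n$, $\lambda\in[0,1]$. An $\mathcal X$-regularizer is a function $h:\mathbb R^n\to\mathbb R\cup\{+\infty\}$ that is strictly convex, lower-semicontinuous, with $\operatorname{cl}\operatorname{dom}h=\mathcal X$ and $\operatorname{dom}h^*=\mathbb R^n$; then $h^*$ is differentiable on $\mathbb R^n$. The multi-valued prox-mapping $\Pi_h$: for $\zeta\in\mathbb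 R^n$, $\Pi_h(\zeta)$ is the set of couples $(x,\vartheta)\in\mathcal X\times\mathbb R^n$ with $x=\nabla h^*(\zeta)$, $\vartheta\in\partial h(x)$, and $\langle\vartheta-\zeta,x'-x\rangle\ge0$ for all $x'\in\mathcal X$. *)

(* Defs.v *)
(* R^n is 'rV[R]_n for R : realType, and functions with
   values in R u {+oo} are maps g : 'rV[R]_n -> \bar R with proper_valued g. *)
From HB Require Import structures.
From mathcomp Require Import all_boot all_order all_algebra.
From mathcomp Require Import all_classical all_reals all_analysis.

Set Implicit Arguments.
Unset Strict Implicit.
Unset Printing Implicit Defensive.

Import Order.TTheory GRing.Theory Num.Theory.
Import numFieldNormedType.Exports.

Local Open Scope classical_set_scope.
Local Open Scope ring_scope.
Local Open Scope ereal_scope.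

Section Defs.
Context {R : realType} {n : nat}.
Local Notation V := 'rV[R]_n.
Implicit Types (N : V -> R) (g h : V -> \bar R) (X : set V) (x v z : V).

Definition dot (u v : V) : R := (\sum_i u ord0 i * v ord0 i)%R.

(* Nonnegativity and N 0 = 0 follow from these three axioms, as in the library
   factory Lmodule_isNormed. *)
Definition is_norm N : Prop :=
  [/\ forall x y, (N (x + y) <= N x + N y)%R,
      forall (a : R) x, N (a *: x)%R = (`|a| * N x)%R &
      forall x, N x = 0%R -> x = 0%R].

(* The maximum over the unit ball, written as a supremum in \bar R: when N is
   a norm the supremum is finite and attained. *)
Definition dual_norm N v : \bar R :=
  ereal_sup [set (dot v x)%:E | x in [set x | (N x <= 1)%R]].

Definition proper_valued g : Prop := forall x, g x != -oo.

Definition effdom g : set V := [set x | g x < +oo].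

(* In \bar R, 0 * +oo = 0, so the inequality holds trivially for l = 0, 1. *)
Definition econvex g : Prop := forall x x' (l : R), (0 <= l <= 1)%R ->
  g (l *: x + (1 - l) *: x')%R <= l%:E * g x + (1 - l)%:E * g x'.

Definition estrictly_convex g : Prop :=
  forall x x' (l : R), effdom g x -> effdom g x' -> x != x' -> (0 < l < 1)%R ->
  g (l *: x + (1 - l) *: x')%R < l%:E * g x + (1 - l)%:E * g x'.

Definition estrongly_convex N g : Prop :=
  forall x x' (l : R), (0 <= l <= 1)%R ->
  g (l *: x + (1 - l) *: x')%R <=
  l%:E * g x + (1 - l)%:E * g x' - (l * (1 - l) / 2 * N (x' - x) ^+ 2)%:E.

(* The first conjunct makes the subdifferential empty outside the domain;
   there, g x' - g x would otherwise depend on the convention for oo - oo. *)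
Definition subdiff g x : set V :=
  [set v | effdom g x /\ forall x', (dot v (x' - x))%:E <= g x' - g x].

Definition conjugate g v : \bar R := ereal_sup [set (dot v x)%:E - g x | x in setT].

Definition bregman g x' x v : \bar R := g x' - g x - (dot v (x' - x))%:E.

Definition regularizer X h : Prop :=
  [/\ proper_valued h, estrictly_convex h, lower_semicontinuous h,
      closure (effdom h) = X & effdom (conjugate h) = setT].

Definition is_gradient (G : V -> R) z x : Prop :=
  is_diff z (G : V -> R^o) (fun v => dot x v).

(* fine : \bar R -> R is harmless here: the conjugate of a regularizer is
   finite everywhere. *)
Definition prox X h z : set (V * V) :=
  [set p | [/\ X p.1, is_gradient (fun v => fine (conjugate h v)) z p.1,
               subdiff h p.1 p.2 &
               forall x', X x' -> (0 <= dot (p.2 - z) (x' - p.1))%R]].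

End Defs.

(* Main.v *)
(* One prox step decreases D_h(xstar, x_t; theta_t) by at least
   gamma_t <f'(y_t), x_t - xstar> - M^2 gamma_t^2 / 2: this is the three-point
   identity, where strong convexity of h absorbs the displacement x_t - x_{t+1}.
   With S_t = gamma_1 + ... + gamma_t, the averaging rule reads
   S_t (y_{t+1} - y_t) = gamma_{t+1} (x_{t+1} - y_{t+1}), so convexity at
   y_{t+1}, used against both xstar and y_t, bounds the increment of
   S_t (f(y_t) - fstar) by gamma_{t+1} <f'(y_{t+1}), x_{t+1} - xstar>.
   Hence S_T (f(y_T) - fstar) + D_h(xstar, x_{T+1}; theta_{T+1}) is bounded by
   induction on T. *)
Require Import Defs.
From mathcomp Require Import all_boot all_order all_algebra.
From mathcomp Require Import all_classical all_reals all_analysis.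
From mathcomp Require Import ring lra.

Set Implicit Arguments.
Unset Strict Implicit.

Import Order.TTheory GRing.Theory Num.Theory.
Import numFieldNormedType.Exports.

Local Open Scope classical_set_scope.
Local Open Scope ring_scope.

(** * Bilinearity of the scalar product *)

Lemma dotDr (R : realType) (n : nat) (g u v : 'rV[R]_n) :
  dot g (u + v) = dot g u + dot g v.
Proof. by rewrite -big_split; apply: eq_bigr => i _; rewrite mxE mulrDr. Qed.

Lemma dotZr (R : realType) (n : nat) (a : R) (g u : 'rV[R]_n) :
  dot g (a *: u) = a * dot g u.
Proof. by rewrite mulr_sumr; apply: eq_bigr => i _; rewrite mxE mulrCA. Qed.

Lemma dotC (R : realType) (n : nat) (u v : 'rV[R]_n) : dot u v = dot v u.
Proof. by apply: eq_bigr => i _; rewrite mulrC. Qed.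

Lemma dotBr (R : realType) (n : nat) (g u v : 'rV[R]_n) :
  dot g (u - v) = dot g u - dot g v.
Proof. by rewrite dotDr -scaleN1r dotZr mulN1r. Qed.

Lemma dotBl (R : realType) (n : nat) (g u v : 'rV[R]_n) :
  dot (u - v) g = dot u g - dot v g.
Proof. by rewrite dotC dotBr !(dotC g). Qed.

Lemma dotZl (R : realType) (n : nat) (a : R) (g u : 'rV[R]_n) :
  dot (a *: u) g = a * dot u g.
Proof. by rewrite dotC dotZr dotC. Qed.

(** * Norm and dual norm *)

Lemma is_norm_ge0 (R : realType) (n : nat) (N : 'rV[R]_n -> R) u :
  is_norm N -> 0 <= N u.
Proof.
move=> [ND NZ _].
have N0 : N 0 = 0 by rewrite -(scale0r 0) NZ normr0 mul0r.
have := ND u (-1 *: u); rewrite scaleN1r subrr N0 -scaleN1r NZ normrN1 mul1r.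
by lra.
Qed.

Lemma le_dot_norm (R : realType) (n : nat) (N : 'rV[R]_n -> R) (M : R) g u :
  is_norm N -> (dual_norm N g <= M%:E)%E -> dot g u <= M * N u.
Proof.
move=> Nn gM; have [_ NZ N0] := Nn.
have [/N0 ->|Nu0] := eqVneq (N u) 0.
  by rewrite -(scale0r 0) dotZr NZ normr0 !mul0r mulr0.
have Nu : 0 < N u by rewrite lt0r Nu0 is_norm_ge0.
rewrite -ler_pdivrMr // mulrC -dotZr -lee_fin.
apply: le_trans gM; apply: ereal_sup_ubound; exists ((N u)^-1 *: u) => //=.
by rewrite NZ gtr0_norm ?invr_gt0// mulVf.
Qed.

(** * Subgradients and Bregman divergences with real values *)

Lemma effdom_fineK (R : realType) (n : nat) (g : 'rV[R]_n -> \bar R) u :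
  proper_valued g -> effdom g u -> (fine (g u))%:E = g u.
Proof. by move=> gP gu; rewrite fineK// fin_numE gP -ltey gu. Qed.

Lemma subdiff_fine (R : realType) (n : nat) (g : 'rV[R]_n -> \bar R) u v z :
  proper_valued g -> subdiff g u z -> effdom g v ->
  dot z (v - u) <= fine (g v) - fine (g u).
Proof.
move=> gP [gu /(_ v) + gv].
by rewrite -(effdom_fineK gP gu) -(effdom_fineK gP gv) lee_fin.
Qed.

Lemma bregman_fineE (R : realType) (n : nat) (g : 'rV[R]_n -> \bar R) u v z :
  proper_valued g -> effdom g v -> effdom g u ->
  bregman g v u z = (fine (g v) - fine (g u) - dot z (v - u))%:E.
Proof.
by move=> gP gv gu; rewrite /bregman !EFinB !(effdom_fineK gP).
Qed.

Lemma bregman_strong (R : realType) (n : nat) (N : 'rV[R]_n -> R)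
    (g : 'rV[R]_n -> \bar R) u v z :
  proper_valued g -> estrongly_convex N g -> subdiff g u z -> effdom g v ->
  N (u - v) ^+ 2 / 2 <= fine (g v) - fine (g u) - dot z (v - u).
Proof.
move=> gP gN guz gv; have [gu _] := guz.
set D := (X in _ <= X); set q := (X in X <= _).
(* The subgradient inequality is compared with strong convexity at
   l *: v + (1 - l) *: u; letting l tend to 0 then yields q <= D. *)
have segment l : 0 < l -> l <= 1 -> (1 - l) * q <= D.
  move=> l0 l1.
  have := gN v u l; rewrite (ltW l0) l1 => /(_ isT).
  rewrite -(effdom_fineK gP gu) -(effdom_fineK gP gv).
  rewrite -!EFinM -!EFinD => gl.
  have gw : effdom g (l *: v + (1 - l) *: u) by apply: le_lt_trans gl (ltry _).
  have := subdiff_fine gP guz gw.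
  rewrite -(effdom_fineK gP gw) lee_fin in gl.
  have -> : l *: v + (1 - l) *: u - u = l *: (v - u).
    by rewrite scalerBl scale1r scalerBr addrA addrAC addrK.
  rewrite dotZr => gsub.
  rewrite -(ler_pM2l l0) /D /q.
  lra.
apply/ler_addgt0Pr => e e0.
have [q0|q0] := leP q 0.
  have := segment 1 ltr01 (lexx _); lra.
have eq0 : 0 < q + e by rewrite addr_gt0.
(* This [l] replaces the limit: it turns [segment] into [q * q <= D * (q + e)], while [D + e < q]
   would give [D * (q + e) < q * q - e * e]. *)
have := segment (e / (q + e)); rewrite divr_gt0// ler_pdivrMr// mul1r.
rewrite lerDr (ltW q0) => /(_ isT isT).
have -> : 1 - e / (q + e) = q / (q + e) by field; rewrite gt_eqF.
move=> qD.
have : q * q <= D * (q + e) by rewrite -ler_pdivrMr // mulrAC.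
nra.
Qed.

Lemma prox_step (R : realType) (n : nat) (N : 'rV[R]_n -> R) (M a : R)
    (h : 'rV[R]_n -> \bar R) (x x' theta theta' g u : 'rV[R]_n) :
  is_norm N -> proper_valued h -> estrongly_convex N h ->
  subdiff h x theta -> subdiff h x' theta' -> effdom h u ->
  0 < a -> (dual_norm N g <= M%:E)%E ->
  0 <= dot (theta' - (theta - a *: g)) (u - x') ->
  a * dot g (x - u) <= fine (bregman h u x theta)
    - fine (bregman h u x' theta') + M ^+ 2 / 2 * a ^+ 2.
Proof.
move=> Nn hP hN hx hx' hu a0 gM var.
have [dx _] := hx; have [dx' _] := hx'.
rewrite !bregman_fineE //=.
have := bregman_strong hP hN hx dx'.
have agxx' : a * dot g (x - x') <= a * (M * N (x - x')).
  by rewrite ler_pM2l// le_dot_norm.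
(* Young's inequality: [a * M * N (x - x')] is at most half the squared norm, which strong convexity
   pays for, plus half of [(a * M) ^+ 2]. *)
have := sqr_ge0 (N (x - x') - a * M).
move: var agxx'; rewrite !dotBl dotZl !dotBr.
nra.
Qed.

(* The case S = 0 lets the induction start at T = 0, where y 0 is arbitrary. *)
Lemma averaging_step (R : realType) (n : nat) (f : 'rV[R]_n -> \bar R)
    (S a : R) (y y' x g u : 'rV[R]_n) :
  proper_valued f -> subdiff f y' g -> effdom f u ->
  0 <= S -> 0 < a -> (S == 0) || `[< effdom f y >] ->
  S *: (y' - y) = a *: (x - y') ->
  (S + a) * (fine (f y') - fine (f u))
    <= S * (fine (f y) - fine (f u)) + a * dot g (x - u).
Proof.
move=> fP fg fu S0 a0 fy Sy.
have fgu := subdiff_fine fP fg fu.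
have := congr1 (dot g) Sy; rewrite !dotZr !dotBr => Sg.
(* If [S] is 0, [f y] may be infinite and [fine (f y)] a default value, but the factor cancels
   it. *)
have Sgy : S * (fine (f y') - fine (f y)) <= S * (dot g y' - dot g y).
  case/orP: fy => [/eqP ->|/asboolP fy]; first by rewrite !mul0r.
  rewrite ler_wpM2l//.
  have := subdiff_fine fP fg fy; rewrite dotBr; lra.
have : a * dot g (u - y') <= a * (fine (f u) - fine (f y')).
  by rewrite ler_pM2l.
rewrite dotBr; lra.
Qed.

Theorem proposition4p2 (R : realType) (n : nat)
    (X : set 'rV[R]_n) (N : 'rV[R]_n -> R)
    (h f : 'rV[R]_n -> \bar R) (M : R)
    (xstar : 'rV[R]_n) (fstar : \bar R)
    (gamma nu : nat -> R) (x y theta f' : nat -> 'rV[R]_n)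
    (X_nonempty : X !=set0) (X_closed : closed X) (X_convex : convex_set X)
    (N_norm : is_norm N)
    (h_reg : regularizer X h) (h_strong : estrongly_convex N h)
    (M_gt0 : 0 < M)
    (f_proper : proper_valued f) (f_convex : econvex f)
    (f_dom : X `<=` effdom f)
    (f_subdiff : forall u, X u -> subdiff f u !=set0)
    (f_bounded : forall u z, X u -> subdiff f u z -> (dual_norm N z <= M%:E)%E)
    (fstar_min : fstar = ereal_inf (f @` X))
    (xstar_X : X xstar) (f_xstar : f xstar = fstar)
    (xstar_dom : effdom h xstar)
    (gamma_gt0 : forall t, (1 <= t)%N -> 0 < gamma t)
    (x1y1 : x 1%N = y 1%N) (theta1 : subdiff h (x 1%N) (theta 1%N))
    (f'_subdiff : forall t, (1 <= t)%N -> subdiff f (y t) (f' t))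
    (nuE : forall t, (1 <= t)%N ->
       nu t = gamma t.+1 * (\sum_(1 <= s < t.+2) gamma s)^-1)
    (x_theta_rec : forall t, (1 <= t)%N ->
       prox X h (theta t - gamma t *: f' t) (x t.+1, theta t.+1))
    (y_rec : forall t, (1 <= t)%N ->
       y t.+1 = (1 - nu t) *: y t + nu t *: x t.+1) :
  (forall T : nat, (1 <= T)%N ->
     (f (y T) - fstar <=
      ((\sum_(1 <= t < T.+1) gamma t)^-1)%:E *
      (bregman h xstar (x 1%N) (theta 1%N) +
       (M ^+ 2 / 2 * \sum_(1 <= t < T.+1) gamma t ^+ 2)%:E))%E) /\
  (forall (T : nat) (Omega : R), (1 <= T)%N -> 0 < Omega ->
     (sqrte (2%:E * bregman h xstar (x 1%N) (theta 1%N)) <= Omega%:E)%E ->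
     (forall t, (1 <= t)%N -> gamma t = Omega / (M * Num.sqrt T%:R)) ->
     (f (y T) - fstar <= (Omega * M / Num.sqrt T%:R)%:E)%E).
Proof.

(* Feasibility of the iterates *)
have [hP _ _ hX _] := h_reg.
have dom_X u : effdom h u -> X u by rewrite -hX; exact: subset_closure.
have theta_sub t : (1 <= t)%N -> subdiff h (x t) (theta t).
  by case: t => [//|[|t]] _ //; have [] := x_theta_rec t.+1 isT.
have x_dom t : (1 <= t)%N -> effdom h (x t) by move=> /theta_sub [].
pose S T := \sum_(1 <= t < T.+1) gamma t.
have S0 : S 0%N = 0 by rewrite /S big_nil.
have SS T : S T.+1 = S T + gamma T.+1 by rewrite /S big_nat_recr.
have S_ge0 T : 0 <= S T.
  elim: T => [|T IH]; rewrite ?S0// SS addr_ge0// ltW// gamma_gt0//.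
have S_gt0 T : (1 <= T)%N -> 0 < S T.
  by case: T => // T _; rewrite SS ltr_wpDl// gamma_gt0.
have nuS t : (1 <= t)%N -> nu t = gamma t.+1 / S t.+1 by exact: nuE.
have y_X t : (1 <= t)%N -> X (y t).
  elim: t => // -[_ _|t /(_ isT) IH _].
    by rewrite -x1y1; exact/dom_X/x_dom.
  (* The weight is the share of the last step-size in [S t.+2], so [y t.+2] is a convex combination
     of points of [X]. *)
  have nu01 : 0 <= nu t.+1 <= 1.
    rewrite nuS// divr_ge0 ?S_ge0 ?(ltW (gamma_gt0 _ _))//=.
    by rewrite ler_pdivrMr ?S_gt0// mul1r SS lerDr.
  have [nu0 nu1] := andP nu01.
  have := X_convex (x t.+2) (y t.+1) (Itv01 nu0 nu1).
  rewrite !inE => /(_ (dom_X _ (x_dom t.+2 isT)) IH).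
  by rewrite (y_rec t.+1)// addrC.
have f_dom_y t : (1 <= t)%N -> effdom f (y t) by move=> /y_X /f_dom.
have Sy T : S T *: (y T.+1 - y T) = gamma T.+1 *: (x T.+1 - y T.+1).
  (* At [T = 0] both sides vanish, the right one because [x 1 = y 1]. *)
  case: T => [|T]; first by rewrite S0 scale0r x1y1 subrr scaler0.
  have S2 : S T.+2 != 0 by rewrite gt_eqF ?S_gt0.
  have nuT : 1 - nu T.+1 = S T.+1 / S T.+2.
    by rewrite nuS// -{1}(divff S2) -mulrBl [in X in X - _]SS addrK.
  apply/rowP => i; rewrite y_rec// nuT nuS// !mxE.
  by move: S2; rewrite SS => S2; field.

(* Potential argument *)
pose D t := fine (bregman h xstar (x t) (theta t)).
have DE t : (1 <= t)%N -> bregman h xstar (x t) (theta t) = (D t)%:E.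
  by move=> t1; rewrite /D bregman_fineE// ; exact: x_dom.
have D_ge0 t : (1 <= t)%N -> 0 <= D t.
  move=> t1; rewrite /D bregman_fineE //=; last exact: x_dom.
  by rewrite subr_ge0; exact: subdiff_fine (theta_sub _ t1) _.
have fx : effdom f xstar by exact: f_dom.
have potential T : S T * (fine (f (y T)) - fine (f xstar)) + D T.+1
    <= D 1%N + M ^+ 2 / 2 * \sum_(1 <= t < T.+1) gamma t ^+ 2.
  elim: T => [|T IH]; first by rewrite S0 mul0r big_nil mulr0 add0r addr0.
  rewrite big_nat_recr//= mulrDr SS.
  have fT := f'_subdiff T.+1 isT.
  have : (S T == 0) || `[< effdom f (y T) >].
    case: T {IH fT} => [|T]; first by rewrite S0 eqxx.
    by apply/orP; right; apply/asboolP/f_dom_y.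
  move=> /(averaging_step f_proper fT fx (S_ge0 T) (gamma_gt0 T.+1 isT)).
  move=> /(_ _ (Sy T)).
  have [_ _ /= hx' /(_ _ xstar_X) var] := x_theta_rec T.+1 isT.
  (* The product of [f' T.+1] with [x T.+1 - xstar] bounds the averaging increment and is bounded by
     the drop of [D], so it cancels in the sum. *)
  have := prox_step N_norm hP h_strong (theta_sub T.+1 isT) hx' xstar_dom
    (gamma_gt0 T.+1 isT) (f_bounded _ _ (y_X T.+1 isT) fT) var.
  rewrite -!/(D _); lra.
have gap T : (1 <= T)%N -> (f (y T) - fstar)%E
    = (fine (f (y T)) - fine (f xstar))%:E.
  by move=> T1; rewrite EFinB !effdom_fineK ?f_xstar//; exact: f_dom_y.
have bound T : (1 <= T)%N -> fine (f (y T)) - fine (f xstar) <=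
    (S T)^-1 * (D 1%N + M ^+ 2 / 2 * \sum_(1 <= t < T.+1) gamma t ^+ 2).
  move=> T1; rewrite mulrC ler_pdivlMr ?S_gt0// mulrC.
  by apply: le_trans (potential T); rewrite lerDl D_ge0.
split=> [T T1|T Omega T1 Omega0].
  by rewrite gap// DE// -EFinD -EFinM lee_fin; exact: bound.

(* Constant step-sizes *)
rewrite DE// -EFinM /= lee_fin => sqrtD gammaE.
rewrite gap// lee_fin; apply: le_trans (bound T T1) _.
have D2 : 2 * D 1%N <= Omega ^+ 2.
  rewrite -[leLHS]sqr_sqrtr; last by rewrite mulr_ge0 ?D_ge0.
  by rewrite lerXn2r ?nnegrE ?sqrtr_ge0 ?(ltW Omega0).
set r := Num.sqrt T%:R in gammaE *.
have r0 : 0 < r by rewrite sqrtr_gt0 ltr0n.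
have rr : T%:R = r ^+ 2 by rewrite sqr_sqrtr.
have cst c F : (forall t, (1 <= t)%N -> F t = c) ->
    \sum_(1 <= t < T.+1) F t = r ^+ 2 * c.
  move=> Fc; rewrite (eq_big_nat _ _ (F2 := fun=> c)) => [|t /andP[/Fc]//].
  by rewrite sumr_const_nat subSS subn0 -mulr_natl rr.
rewrite /S (cst _ _ gammaE).
rewrite (cst ((Omega / (M * r)) ^+ 2)) => [|t /gammaE ->//].
(* The target is [Omega ^+ 2] divided by [S T]; once this factor is removed, [D 1] and the step-size
   term each contribute at most [Omega ^+ 2 / 2]. *)
have -> : Omega * M / r
    = (r ^+ 2 * (Omega / (M * r)))^-1 * (Omega ^+ 2).
  by field; rewrite !gt_eqF.
rewrite ler_pM2l; last first.
  by rewrite invr_gt0 mulr_gt0 ?exprn_gt0 ?divr_gt0 ?mulr_gt0.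
have -> : M ^+ 2 / 2 * (r ^+ 2 * (Omega / (M * r)) ^+ 2) = Omega ^+ 2 / 2.
  by field; rewrite !gt_eqF.
lra.
Qed.
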